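(* Let $g\geq 13$ be an integer. If $g$ is odd, then the symplectic group $Sp\big(2\lfloor\frac{g-1}{2}\rfloor;\mathbb{Z}_2\big)$ can be generated by three elements, two of which are involutions and the third of which has order $g$. If $g$ is even, then $Sp\big(2\lfloor\frac{g-1}{2}\rfloor;\mathbb{Z}_2\big)$ can be generated by three elements, two of which are involutions and the third of which has order $g-1$.
   Context: Here $\mathbb{Z}_2$ is the field with two elements, and $Sp(2h;\mathbb{Z}_2)$ is the group of linear automorphisms of $\mathbb{Z}_2^{2h}$ preserving a nondegenerate alternating bilinear form (so the argument $2h$ is the dimension of the vector space). An involution is an element of order $2$. *)

(* Defs.v *)
From mathcomp Require Import all_boot all_order all_algebra all_fingroup.

Set Implicit Arguments.
Unset Strict Implicit.
Unset Printing Implicit Defensive.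

Import GRing.Theory.
Local Open Scope ring_scope.

(* Matrices act on row vectors on the right.  As {'GL_n[F]} consists of      *)
(* matrices of size n.-1.+1, so does the space carrying the form; this size  *)
(* is n whenever n > 0.                                                      *)
Definition symplectic_group (n : nat) (F : finFieldType)
    (f : {skew_symmetric 'rV[F]_n.-1.+1}) : {set {'GL_n[F]}} :=
  [set A : {'GL_n[F]} |
    [forall u, forall v, f (u *m GLval A) (v *m GLval A) == f u v]].

Fact symplectic_group_set (n : nat) (F : finFieldType)
    (f : {skew_symmetric 'rV[F]_n.-1.+1}) : group_set (symplectic_group f).
Proof.
apply/group_setP; split=> [|A B].
  by rewrite inE; apply/'forall_'forall_eqP => u v; rewrite GL_1E !mulmx1.
rewrite !inE => /'forall_'forall_eqP fA /'forall_'forall_eqP fB.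
by apply/'forall_'forall_eqP => u v; rewrite GL_MxE !mulmxA fB fA.
Qed.

Canonical symplectic_group_group (n : nat) (F : finFieldType)
  (f : {skew_symmetric 'rV[F]_n.-1.+1}) := Group (symplectic_group_set f).

(* Main.v *)
Require Import Defs.
From mathcomp Require Import all_boot all_order all_algebra all_fingroup.
From mathcomp Require Import cyclic zify.

(** Write m = n + 1, with n even the dimension. There are vectors
    p_0, ..., p_(m-1) spanning the space, with sum 0 and f p_i p_j = 1 for all
    i <> j: for the dot product on the even subsets of an m-element set, p_i is
    the complement of {i}. The element z of order m is the isometry
    p_i |-> p_(i+1), and the involutions are the transvections along p_0 + p_1
    and along a sum of four of the p_i. If the transvections along u and v lie
    in a group and f u v = 1, then so does the one along u + v. The conjugates of
    the first transvection under z thus yield all the transvections along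
    p_i + p_j; these exchange the elements of a subset, so that the second one
    yields all the 4-element sums, hence all the even sums by induction on their
    size. Every vector is an even sum, and the transvections generate the
    symplectic group. *)

Set Implicit Arguments.
Unset Strict Implicit.
Unset Printing Implicit Defensive.

Import GRing.Theory.
Local Open Scope ring_scope.

(** * Arithmetic over the field with two elements *)

Lemma F2_eq1 (x : 'F_2) : x != 0 -> x = 1.
Proof. by case: x => [[|[|//]]] ? // _; apply: val_inj. Qed.

Lemma F2_addvv (V : lmodType 'F_2) (v : V) : v + v = 0.
Proof.
by rewrite -[v]scale1r -scalerDl (_ : 1 + 1 = 0) ?scale0r //; apply: val_inj.
Qed.

Lemma F2_oppv (V : lmodType 'F_2) (v : V) : - v = v.
Proof. by apply/eqP; rewrite eq_sym -addr_eq0 F2_addvv. Qed.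

Lemma F2_addxx (x : 'F_2) : x + x = 0.
Proof. exact: addrr_pchar2 (pchar_Fp _) _. Qed.

(** * Transvections as elements of the symplectic group *)

Section Transvections.
Variables (n : nat) (f : {skew_symmetric 'rV['F_2]_n.+1}).
Hypothesis f_alt : forall u, f u u = 0.
Hypothesis f_nondeg : forall u, (forall v, f u v = 0) -> u = 0.

Lemma formC u v : f u v = f v u.
Proof. by rewrite hermC /= expr1 mulN1r (oppr_pchar2 (pchar_Fp _)). Qed.

Lemma exists_form1 u : u != 0 -> exists v, f u v = 1.
Proof.
move=> u0; have [/existsP[v /eqP]|/existsPn H] := boolP [exists v, f u v == 1].
  by exists v.
case/eqP: u0; apply: f_nondeg => v; apply/eqP; apply: contraR (H v).
by move/F2_eq1->.
Qed.

Definition transvection_mx (v : 'rV['F_2]_n.+1) : 'M['F_2]_n.+1 :=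
  1%:M + (\col_i f 'e_i v) *m v.

Lemma mul_transvection_mx u v : u *m transvection_mx v = u + f u v *: v.
Proof.
rewrite mulmxDr mulmx1 mulmxA -mul_scalar_mx; congr (_ + _ *m _).
apply/matrixP => i j; rewrite !ord1 !mxE eqxx mulr1n [in RHS](row_sum_delta u).
by rewrite linear_sumlz; apply: eq_bigr => k _; rewrite linearZl_LR mxE.
Qed.

Lemma transvection_mxK v : transvection_mx v *m transvection_mx v = 1%:M.
Proof.
apply/row_matrixP => i; rewrite !rowE mulmx1 mulmxA !mul_transvection_mx.
by rewrite linearDl linearZl_LR /= f_alt mulr0 addr0 -addrA F2_addvv addr0.
Qed.

Lemma transvection_unit v : transvection_mx v \is a GRing.unit.
Proof. by case: (mulmx1_unit (transvection_mxK v)). Qed.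

Definition transvection v : {'GL_n.+1['F_2]} :=
  FinRing.Unit (transvection_unit v).

Lemma mul_transvection u v : u *m GLval (transvection v) = u + f u v *: v.
Proof. exact: mul_transvection_mx. Qed.

Lemma GL_eqP (A B : {'GL_n.+1['F_2]}) :
  (forall u : 'rV_n.+1, u *m GLval A = u *m GLval B) -> A = B.
Proof. by move=> H; apply/val_inj/row_matrixP=> i; rewrite !rowE H. Qed.

Lemma symplecticP (A : {'GL_n.+1['F_2]}) :
  reflect (forall u v : 'rV_n.+1, f (u *m GLval A) (v *m GLval A) = f u v)
    (A \in symplectic_group (n := n.+1) f).
Proof. by rewrite inE; apply: 'forall_'forall_eqP. Qed.

Lemma transvection_symplectic v :
  transvection v \in symplectic_group (n := n.+1) f.
Proof.
apply/symplecticP => u w; rewrite !mul_transvection !(linearDl, linearDr).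
rewrite !(linearZl_LR, linearZr_LR) /= f_alt !mulr0 addr0 -addrA.
by rewrite [f v w]formC mulrC F2_addxx addr0.
Qed.

Lemma transvection_mulK (u v : 'rV_n.+1) :
  u *m GLval (transvection v) *m GLval (transvection v) = u.
Proof. by rewrite -mulmxA [X in u *m X]transvection_mxK mulmx1. Qed.

Lemma transvection_order v : v != 0 -> #[transvection v]%g = 2%N.
Proof.
move=> v0; apply/prime.prime_nt_dvdP => //; last first.
  rewrite order_dvdn expgS expg1; apply/eqP/GL_eqP => u.
  by rewrite GL_MxE mulmxA transvection_mulK mulmx1.
rewrite order_eq1; have [u fvu] := exists_form1 v0.
apply: contra v0 => /eqP tv1.
have := mul_transvection u v; rewrite tv1 mulmx1 formC fvu scale1r => /eqP.
by rewrite addrC -subr_eq subrr eq_sym.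
Qed.

Lemma transvection0 : transvection 0 = 1%g.
Proof.
by apply: GL_eqP => u; rewrite mul_transvection scaler0 addr0 mulmx1.
Qed.

Lemma transvection_conj (A : {'GL_n.+1['F_2]}) v :
  A \in symplectic_group (n := n.+1) f ->
  (transvection v ^ A)%g = transvection (v *m GLval A).
Proof.
move/symplecticP => fA; apply: (mulgI A); rewrite -conjgC.
apply: GL_eqP => u; rewrite !GL_MxE !mulmxA.
by rewrite !mul_transvection mulmxDl -scalemxAl fA.
Qed.


(** * Generation of the symplectic group by transvections *)

Definition moved (A : {'GL_n.+1['F_2]}) :=
  [set u : 'rV_n.+1 | u *m GLval A != u].

(** If [A] fixes [w], then [f w (x *m A) = f (w *m A) (x *m A) = f w x], so [w] is orthogonal to
    [x + x *m A]. *)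
Lemma moved_mul_transvection (A : {'GL_n.+1['F_2]}) x :
  A \in symplectic_group (n := n.+1) f ->
  moved (A * transvection (x + x *m GLval A))%g \subset moved A.
Proof.
move/symplecticP => fA; apply/subsetP => w; rewrite !inE.
apply: contra => /eqP wA.
rewrite GL_MxE mulmxA mul_transvection wA linearDr /= -{1}wA.
by rewrite -(fA w x) wA F2_addxx scale0r addr0.
Qed.

(** The transvection along [v + v *m A] carries [v *m A] back to [v]. *)
Lemma moved_decrease (A : {'GL_n.+1['F_2]}) v :
  A \in symplectic_group (n := n.+1) f -> f v (v *m GLval A) = 1 ->
  v \notin moved (A * transvection (v + v *m GLval A))%g.
Proof.
move=> SpA fv; rewrite inE negbK GL_MxE mulmxA mul_transvection linearDr /=.
by rewrite f_alt addr0 formC fv scale1r addrC -addrA F2_addvv addr0.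
Qed.

(* With [f v (v *m A) = 0], one moves [v *m A] along [D x = x + x *m A], which
   is orthogonal to the vectors fixed by [A] and has to be orthogonal neither to
   [v] nor to [v *m A]: such [x] exists as two hyperplanes do not cover the
   space. *)
Lemma exists_form1_moved (A : {'GL_n.+1['F_2]}) v :
    A \in symplectic_group (n := n.+1) f -> v \in moved A ->
  exists x, f v (v *m GLval (A * transvection (x + x *m GLval A))%g) = 1.
Proof.
move=> SpA; have fA := symplecticP _ SpA.
rewrite inE => vA.
have [/F2_eq1 fv|/negPn/eqP fv] := boolP (f v (v *m GLval A) != 0).
  exists 0; rewrite mul0mx addr0 GL_MxE mulmxA mul_transvection.
  by rewrite scaler0 addr0.
have [y fy] : exists y, f (v + v *m GLval A) y = 1.
  apply: exists_form1; apply: contra vA => /eqP vA0.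
  by rewrite -[X in X == _]add0r -{1}(F2_addvv v) -addrA vA0 addr0.
pose D (x : 'rV_n.+1) := x + x *m GLval A.
have DvA x : f (v *m GLval A) (D x) = f (v + v *m GLval A) x.
  by rewrite /D linearDr /= linearDl /= fA addrC.
have Dv x : f v (D x) = f (v + v *m GLval A) (x *m GLval A).
  by rewrite /D linearDr /= linearDl /= fA addrC.
suff [x Dx1 Dx2] : exists2 x, f v (D x) = 1 & f (v *m GLval A) (D x) = 1.
  exists x; rewrite GL_MxE mulmxA mul_transvection linearDr /= fv add0r.
  by rewrite linearZr_LR /= -/(D x) Dx1 Dx2 mulr1.
(* [y] meets the second condition and [z] the first; if each fails the other one, [y + z] meets
   both. *)
pose z := y *m GLval (A^-1)%g.
have zA : z *m GLval A = y.
  by rewrite /z -mulmxA -[X in y *m X](GL_MxE A^-1%g A) mulVg mulmx1.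
have [/F2_eq1 Dy1|/negPn/eqP Dy0] := boolP (f v (D y) != 0).
  by exists y; rewrite // DvA.
have [/F2_eq1 Dz1|/negPn/eqP Dz0] := boolP (f (v *m GLval A) (D z) != 0).
  by exists z; rewrite // Dv zA.
have DD : D (y + z) = D y + D z by rewrite /D mulmxDl addrACA.
exists (y + z);
  by rewrite DD linearDr /= ?Dy0 ?Dz0 ?Dv ?DvA ?zA fy (addr0, add0r).
Qed.

(** Induction on the number of moved vectors: one transvection makes [f v (v *m B) = 1] for a moved
    [v], a second one then fixes [v], and neither moves a vector that was fixed before. *)
Lemma symplectic_sub_transvections (H : {group {'GL_n.+1['F_2]}}) :
  (forall v, transvection v \in H) -> symplectic_group (n := n.+1) f \subset H.
Proof.
move=> tH; apply/subsetP => A.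
have [k] := ubnP #|moved A|; elim: k => // k IHk in A *; rewrite ltnS => Ak SpA.
have [A0|[v vA]] := set_0Vmem (moved A).
  rewrite (_ : A = 1%g) ?group1 //; apply: GL_eqP => u; rewrite mulmx1.
  by apply/eqP; have := in_set0 u; rewrite -A0 inE => /negbT/negPn.
have [x fvB] := exists_form1_moved SpA vA.
set B := (A * _)%g in fvB.
have SpB : B \in symplectic_group (n := n.+1) f.
  by rewrite groupM // transvection_symplectic.
rewrite -(groupMr _ (tH (x + x *m GLval A))) -/B.
rewrite -(groupMr _ (tH (v + v *m GLval B))).
apply: IHk; last by rewrite groupM ?transvection_symplectic.
apply: leq_trans Ak; apply: proper_card; apply/properP; split; last first.
  by exists v; rewrite ?moved_decrease.
by rewrite (subset_trans (moved_mul_transvection _ _)) ?moved_mul_transvection.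
Qed.


(** * Construction of equiangular families *)

Lemma exists_orthogonal k (p : 'I_k -> 'rV_n.+1) :
  (k < n.+1)%N -> exists2 v, v != 0 & forall i, f v (p i) = 0.
Proof.
move=> ltkn; pose M := \matrix_(j < n.+1, i < k) f 'e_j (p i).
have: kermx M != 0.
  rewrite kermx_eq0 /row_free; apply: contraL ltkn => /eqP <-.
  by rewrite -leqNgt rank_leq_col.
rewrite -nz_row_eq0 => vn0; exists (nz_row (kermx M)) => // i.
have /sub_kermxP/rowP/(_ i) := nz_row_sub (kermx M); rewrite !mxE => vM.
rewrite [X in f X _]row_sum_delta linear_sumlz -[RHS]vM.
by apply: eq_bigr => j _; rewrite linearZl_LR !mxE.
Qed.

(** The Gram matrix is J + I, with J all ones. The size [N] stays free because the family is built
    two vectors at a time. *)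
Definition equiangular N (p : 'I_N -> 'rV_n.+1) :=
  forall i j, f (p i) (p j) = (i != j)%:R.

Lemma form_sumZ N (p : 'I_N -> 'rV_n.+1) (c : 'I_N -> 'F_2) j :
  equiangular p -> f (\sum_i c i *: p i) (p j) = \sum_i c i + c j.
Proof.
move=> pE; rewrite linear_sumlz (bigD1 j) //= [in RHS](bigD1 j) //=.
rewrite linearZl_LR /= pE eqxx mulr0 add0r addrAC F2_addxx add0r.
by apply: eq_bigr => i ij; rewrite linearZl_LR /= pE ij mulr1.
Qed.

Lemma F2_natr_odd k : k%:R = (odd k)%:R :> 'F_2.
Proof.
elim: k => // k IH; rewrite -natr1 IH /=.
by case: (odd k); apply: val_inj.
Qed.

Lemma form_sum N (p : 'I_N -> 'rV_n.+1) (A : {set 'I_N}) j :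
  equiangular p -> f (\sum_(i in A) p i) (p j) = (odd #|A| (+) (j \in A))%:R.
Proof.
move=> pE; have -> : \sum_(i in A) p i = \sum_i (i \in A)%:R *: p i.
  rewrite big_mkcond; apply: eq_bigr => i _.
  by case: (i \in A); rewrite (scale1r, scale0r).
rewrite form_sumZ // -natr_sum -natrD F2_natr_odd oddD oddb.
by rewrite -sum1_card [in RHS]big_mkcond.
Qed.

Lemma form_sum_all N (p : 'I_N -> 'rV_n.+1) j :
  equiangular p -> f (\sum_i p i) (p j) = (~~ odd N)%:R.
Proof.
move=> pE; have := form_sum [set: 'I_N] j pE.
rewrite inE addbT cardsT card_ord => <-; congr (f _ _).
by apply: eq_bigl => i; rewrite inE.
Qed.

Lemma equiangular_extend N (p : 'I_N -> 'rV_n.+1) :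
    ~~ odd N -> (N < n.+1)%N -> equiangular p ->
  exists q : 'I_N.+2 -> 'rV_n.+1, equiangular q.
Proof.
move=> evN ltNn pE; have [v v0 vp] := exists_orthogonal p ltNn.
have [w vw] := exists_form1 v0.
pose s := \sum_i p i.
have sp i : f s (p i) = 1.
  by rewrite form_sum_all // evN.
pose d i := f w (p i).
(* Let D be the sum of all the [d i]. Against [p i] the three terms take the values [d i], D and D +
   [d i], so [w'] is orthogonal to every [p i]. *)
pose w' := w + (\sum_i d i) *: s + \sum_i d i *: p i.
have w'p i : f w' (p i) = 0.
  rewrite /w' !linearDl linearZl_LR /= form_sumZ //= sp mulr1 -/(d i).
  by rewrite [X in _ + X]addrC F2_addxx.
have vs : f v s = 0 by rewrite linear_sumr big1 // => i _; apply: vp.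
have w's : f w' s = 0 by rewrite linear_sumr big1 // => i _; apply: w'p.
have vw' : f v w' = 1.
  rewrite /w' !linearDr linearZr_LR /= vs mulr0 addr0.
  rewrite linear_sumr big1 ?addr0 //.
  by move=> i _; rewrite linearZr_LR /= vp mulr0.
(* The hyperbolic pair [v, w'] is orthogonal to all the [p i], whereas [s] has
   value [1] against each of them. *)
pose q i := if unlift ord_max i is Some j then
  if unlift ord_max j is Some k then p k else v + s else w' + s.
have qm : q ord_max = w' + s by rewrite /q unlift_none.
have ql : q (lift ord_max ord_max) = v + s by rewrite /q liftK unlift_none.
have qp i : q (lift ord_max (lift ord_max i)) = p i by rewrite /q !liftK.
have ind (P : 'I_N.+2 -> Prop) : P ord_max -> P (lift ord_max ord_max) ->
    (forall i, P (lift ord_max (lift ord_max i))) -> forall i, P i.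
  move=> P1 P2 P3 i; case: (unliftP ord_max i) => [j|] -> //.
  by case: (unliftP ord_max j) => [k|] ->.
have wv : f (w' + s) (v + s) = 1.
  rewrite linearDl !linearDr /= [f w' v]formC vw' w's [f s v]formC vs f_alt.
  by rewrite !addr0.
have w'sp i : f (w' + s) (p i) = 1 by rewrite linearDl /= w'p sp add0r.
have vsp i : f (v + s) (p i) = 1 by rewrite linearDl /= vp sp add0r.
have lm k (i : 'I_k) : (lift ord_max i == ord_max) = false.
  by rewrite eq_sym; apply/negbTE/neq_lift.
exists q => i j; elim/ind: i => [||i]; elim/ind: j => [||j];
  rewrite ?qm ?ql ?qp ?w'sp ?vsp ?pE ?f_alt ?eqxx //.
- by rewrite wv eq_sym lm.
- by rewrite eq_sym lm.
- by rewrite formC wv lm.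
- by rewrite (inj_eq lift_inj) eq_sym lm.
- by rewrite formC w'sp lm.
- by rewrite formC vsp (inj_eq lift_inj) lm.
- by rewrite !(inj_eq lift_inj).
Qed.

Lemma exists_equiangular N : ~~ odd N -> (N <= n.+1)%N ->
  exists p : 'I_N -> 'rV_n.+1, equiangular p.
Proof.
move=> evN; rewrite -[N]even_halfK //; move: N./2 => k {evN N}.
elim: k => [|k IHk] ltkn; first by exists (fun=> 0) => -[].
have [|p pE] := IHk; first by apply: leq_trans ltkn; rewrite doubleS ltnW.
rewrite doubleS; apply: (equiangular_extend _ _ pE).
  by rewrite odd_double.
by apply: leq_trans ltkn; rewrite doubleS.
Qed.

(** * Equiangular families that span the space *)

Lemma equiangular_unitmx (p : 'I_n.+1 -> 'rV_n.+1) :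
  ~~ odd n.+1 -> equiangular p -> \matrix_i p i \in unitmx.
Proof.
move=> evn pE; rewrite -row_free_unit; apply: inj_row_free => u.
rewrite mulmx_sum_row; under eq_bigr do rewrite rowK; move=> uS0.
(* In a linear relation every coefficient equals the sum of all of them; this sum then vanishes
   because [n.+1] is even. *)
have uE j : u 0 j = \sum_i u 0 i.
  have := form_sumZ (u 0) j pE; rewrite uS0 linear0l => /esym/eqP.
  by rewrite addrC addr_eq0 (oppr_pchar2 (pchar_Fp _)) // => /eqP.
have u0 : \sum_i u 0 i = 0.
  under eq_bigr do rewrite uE.
  by rewrite sumr_const card_ord -mulr_natr F2_natr_odd (negPf evn) mulr0.
by apply/rowP => i; rewrite uE u0 mxE.
Qed.

Lemma equiangular_span (p : 'I_n.+1 -> 'rV_n.+1) v :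
  ~~ odd n.+1 -> equiangular p -> exists c, v = \sum_i c i *: p i.
Proof.
move=> evn pE; exists (fun i => (v *m invmx (\matrix_i p i)) 0 i).
rewrite -[LHS](mulmxKV (equiangular_unitmx evn pE)) mulmx_sum_row.
by apply: eq_bigr => i _; rewrite rowK.
Qed.

(** As [n.+2] is odd, the sum is orthogonal to every [p i], and these span the space. *)
Lemma equiangular_sum0 (p : 'I_n.+2 -> 'rV_n.+1) :
  ~~ odd n.+1 -> equiangular p -> \sum_i p i = 0.
Proof.
move=> evn pE; apply: f_nondeg => v.
have [|c ->] := equiangular_span (p := p \o lift ord_max) v evn.
  by move=> i j; rewrite /= pE (inj_eq lift_inj).
rewrite linear_sumr big1 // => i _; rewrite linearZr_LR /=.
by rewrite form_sum_all // [odd _]/= -/(odd n.+1) evn mulr0.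
Qed.

(** Since all the vectors sum to 0, a subset and its complement have the same sum; their sizes
    differ in parity as [n.+2] is odd. *)
Lemma equiangular_span_even (p : 'I_n.+2 -> 'rV_n.+1) v :
    ~~ odd n.+1 -> equiangular p ->
  exists2 A : {set 'I_n.+2}, ~~ odd #|A| & v = \sum_(i in A) p i.
Proof.
move=> evn pE; pose q := p \o lift ord_max.
have [|c vE] := equiangular_span (p := q) v evn.
  by move=> i j; rewrite /q /= pE (inj_eq lift_inj).
have [A vA] : exists A : {set 'I_n.+2}, v = \sum_(i in A) p i.
  exists (lift ord_max @: [set i | c i != 0]).
  rewrite big_imset /=; last by move=> ? ? _ _; apply: lift_inj.
  rewrite vE [RHS]big_mkcond; apply: eq_bigr => i _; rewrite inE.
  by case: eqVneq => [->|/F2_eq1 ->]; rewrite (scale0r, scale1r).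
have [oddA|] := boolP (odd #|A|); last by exists A.
exists (~: A).
  have := cardsC A; rewrite card_ord => /(congr1 odd).
  by rewrite oddD oddA /= => ->.
have := equiangular_sum0 evn pE.
rewrite (bigID (mem A)) /= -vA => /eqP; rewrite addr_eq0 => /eqP ->.
rewrite F2_oppv.
by apply: eq_bigl => i; rewrite inE.
Qed.

(** The extra vector is the sum of [n.+1] equiangular ones: their number being even, it has value 1
    against each. *)
Lemma exists_equiangular_top : ~~ odd n.+1 ->
  exists p : 'I_n.+2 -> 'rV_n.+1, equiangular p.
Proof.
move=> evn; have [p pE] := exists_equiangular evn (leqnn _).
pose s := \sum_i p i.
have sp i : f s (p i) = 1.
  by rewrite form_sum_all // evn.
exists (fun i => if unlift ord_max i is Some j then p j else s) => i j.
case: (unliftP ord_max i) => [i'|] ->; case: (unliftP ord_max j) => [j'|] ->;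
  rewrite ?liftK ?unlift_none ?f_alt ?eqxx //.
- by rewrite pE (inj_eq lift_inj).
- by rewrite formC sp eq_sym neq_lift.
- by rewrite sp neq_lift.
Qed.

Lemma equiangular_lift (p : 'I_n.+2 -> 'rV_n.+1) :
  equiangular p -> equiangular (p \o lift ord_max).
Proof. by move=> pE i j; rewrite /= pE (inj_eq lift_inj). Qed.

Lemma form_sumZ2 N (p : 'I_N -> 'rV_n.+1) (c d : 'I_N -> 'F_2) :
    equiangular p ->
  f (\sum_i c i *: p i) (\sum_j d j *: p j) = \sum_j d j * (\sum_i c i + c j).
Proof.
move=> pE; rewrite linear_sumr; apply: eq_bigr => j _.
by rewrite linearZr_LR /= form_sumZ.
Qed.

(** The first [n.+1] vectors of both families form bases with the same Gram matrix. In both, the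
    last vector is the sum of the others, so the change of basis matches it too. *)
Lemma equiangular_isometry (p q : 'I_n.+2 -> 'rV_n.+1) :
    ~~ odd n.+1 -> equiangular p -> equiangular q ->
  exists2 A, A \in symplectic_group (n := n.+1) f &
    forall i, p i *m GLval A = q i.
Proof.
move=> evn pE qE.
have pU := equiangular_unitmx evn (equiangular_lift pE).
have qU := equiangular_unitmx evn (equiangular_lift qE).
set P := \matrix_i _ in pU; set R := \matrix_i _ in qU.
have U : invmx P *m R \is a GRing.unit by rewrite unitmx_mul unitmx_inv pU.
have lE i : p (lift ord_max i) *m (invmx P *m R) = q (lift ord_max i).
  have -> : p (lift ord_max i) = row i P by rewrite rowK.
  by rewrite -row_mul mulmxA mulmxV // mul1mx rowK.
have top (r : 'I_n.+2 -> 'rV_n.+1) : equiangular r ->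
    r ord_max = \sum_i r (lift ord_max i).
  move=> rE; have /eqP := equiangular_sum0 evn rE.
  rewrite (bigD1_ord ord_max) //= addr_eq0 => /eqP ->.
  by rewrite F2_oppv.
exists (FinRing.Unit U) => [|i]; last first.
  case: (unliftP ord_max i) => [j|] -> //.
  by rewrite !top // mulmx_suml; apply: eq_bigr => j _; apply: lE.
have mE (c : 'I_n.+1 -> 'F_2) : (\sum_i c i *: p (lift ord_max i)) *m
    (invmx P *m R) = \sum_i c i *: q (lift ord_max i).
  by rewrite mulmx_suml; apply: eq_bigr => i _; rewrite -scalemxAl lE.
apply/symplecticP => u v.
have [c ->] := equiangular_span u evn (equiangular_lift pE).
have [d ->] := equiangular_span v evn (equiangular_lift pE).
rewrite [_ *m _ in X in f X]mE [_ *m _ in X in f _ X]mE.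
by rewrite (form_sumZ2 _ _ (equiangular_lift pE))
  (form_sumZ2 _ _ (equiangular_lift qE)).
Qed.

(** * From pairs and one 4-element sum to all even sums *)

Section Generation.
Variables (H : {group {'GL_n.+1['F_2]}}) (p : 'I_n.+2 -> 'rV['F_2]_n.+1).
Hypotheses (evn : ~~ odd n.+1) (pE : equiangular p).

Lemma transvectionD u v : transvection u \in H -> transvection v \in H ->
  f u v = 1 -> transvection (u + v) \in H.
Proof.
move=> Hu Hv fuv; have := groupJ Hu Hv.
rewrite transvection_conj ?transvection_symplectic //.
by rewrite mul_transvection fuv scale1r.
Qed.

Lemma transvection_chain i j k : transvection (p i + p j) \in H ->
  transvection (p j + p k) \in H -> transvection (p i + p k) \in H.
Proof.
have [->|ij] := eqVneq i j; first by [].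
have [->|jk] := eqVneq j k; first by [].
have [->|ik] := eqVneq i k; first by rewrite F2_addvv transvection0 group1.
move=> Hij Hjk; have -> : p i + p k = (p i + p j) + (p j + p k).
  by rewrite addrA -[p i + _ + _]addrA F2_addvv addr0.
apply: transvectionD => //.
(* Three of the four terms are 1. *)
rewrite !(linearDl, linearDr) /= !pE ij ik jk eqxx /= add0r.
by rewrite F2_addxx add0r.
Qed.

Lemma transvection_pair : (forall i, transvection (p i + p (i + 1)) \in H) ->
  forall i j, transvection (p i + p j) \in H.
Proof.
move=> H1 i j; rewrite -[j](subrK i) -(natr_Zp (j - i)) [_ + i]addrC.
elim: (val _) => [|k IHk].
  by rewrite mulr0n addr0 F2_addvv transvection0 group1.
by apply: transvection_chain IHk _; rewrite -natr1 addrA.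
Qed.

Hypothesis Hpair : forall i j, transvection (p i + p j) \in H.

(** Induction on the size of [B :\: A]. Replacing [i] in [B :\: A] by [j] in [A :\: B] changes the
    sum by [p i + p j]; the sum over the new set has value 1 against it, as that set contains [j]
    but not [i]. *)
Lemma transvection_exchange (A B : {set 'I_n.+2}) : #|A| = #|B| ->
  transvection (\sum_(i in A) p i) \in H ->
  transvection (\sum_(i in B) p i) \in H.
Proof.
move=> AB HA; have [k] := ubnP #|B :\: A|.
elim: k => // k IHk in B AB *; rewrite ltnS => BAk.
have [/eqP|[i]] := set_0Vmem (B :\: A).
  rewrite setD_eq0 => sBA; suff -> : B = A by [].
  by apply/eqP; rewrite eqEcard sBA AB leqnn.
rewrite inE => /andP[iA iB].
have [AB0|[j]] := set_0Vmem (A :\: B).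
  move/eqP: AB0; rewrite setD_eq0 => sAB.
  case/negP: iA; move: iB; rewrite (_ : A = B) //.
  by apply/eqP; rewrite eqEcard sAB AB /=.
rewrite inE => /andP[jB jA].
pose B' := j |: (B :\ i).
have B'E : #|B| = #|B'|.
  by rewrite cardsU1 !inE (negPf jB) andbF [LHS](cardsD1 i) iB.
have HB' : transvection (\sum_(i in B') p i) \in H.
  apply: IHk; first by rewrite AB.
  apply: leq_trans BAk; apply: proper_card; apply/properP; split.
    apply/subsetP => l; rewrite !inE => /andP[lA /predU1P[lj|/andP[_ ->]]].
      by rewrite lj jA in lA.
    by rewrite lA.
  exists i; first by rewrite inE iA.
  by rewrite !inE eqxx /= orbF; apply: contraNN jB => /andP[_ /eqP <-].
have sB : \sum_(i in B) p i = \sum_(i in B') p i + (p i + p j).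
  rewrite (big_setD1 i) //= big_setU1 ?inE ?(negPf jB) ?andbF //=.
  by rewrite [p i + p j]addrC addrACA F2_addvv add0r addrC.
rewrite sB; apply: transvectionD => //; rewrite linearDr /= !form_sum // -natrD.
have -> : j \in B' by rewrite !inE eqxx.
have -> : (i \in B') = false.
  by rewrite !inE eqxx orbF; apply: contraNF jB => /eqP <-.
by case: (odd _).
Qed.

(* A set of size 2k + 2 > 2 is the symmetric difference of sets of sizes 2k and 4
   that meet in a single point [e]. *)
Lemma transvection_even (A4 A : {set 'I_n.+2}) : #|A4| = 4%N ->
    transvection (\sum_(i in A4) p i) \in H -> ~~ odd #|A| ->
  transvection (\sum_(i in A) p i) \in H.
Proof.
move=> A4E HA4 evA; have := even_halfK evA; move: #|A|./2 => k.
elim: k => [|[|k] IHk] in A evA *.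
- move/esym/eqP; rewrite cards_eq0 => /eqP ->.
  by rewrite big_set0 transvection0 group1.
- move/esym/eqP/cards2P => [a [b [ab ->]]].
  by rewrite big_setU1 ?inE //= big_set1; apply: Hpair.
move=> Ak; have /card_geqP[s [Us s3 sA]] : (3 <= #|A|)%N.
  by rewrite -Ak !doubleS.
pose D := [set x in s].
have D3 : #|D| = 3%N by rewrite cardsE (card_uniqP Us).
have DA : D \subset A by apply/subsetP => x; rewrite inE => /sA.
(* A point [e] outside [A] exists because [A] has even size and [n.+2] is odd. *)
have [AT0|[e]] := set_0Vmem (~: A).
  by case/negP: evA; have := cardsC A; rewrite AT0 cards0 addn0 card_ord => ->.
rewrite inE => eA.
have eD : e \notin D by apply: contra eA; apply: (subsetP DA).
have eAD : e \notin A :\: D by rewrite inE (negPf eA) andbF.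
pose B := e |: (A :\: D).
have cB : #|B| = k.+1.*2.
  by rewrite cardsU1 eAD cardsDS // D3 -Ak !doubleS.
have HC : transvection (\sum_(i in e |: D) p i) \in H.
  by apply: transvection_exchange HA4; rewrite cardsU1 eD D3.
have HB : transvection (\sum_(i in B) p i) \in H.
  by apply: IHk; rewrite cB // odd_double.
have -> : \sum_(i in A) p i = \sum_(i in e |: D) p i + \sum_(i in B) p i.
  rewrite big_setU1 //= big_setU1 //= addrACA F2_addvv add0r.
  by rewrite (big_setID D) /= (setIidPr DA).
apply: transvectionD => //; rewrite formC.
(* As [B] has even size, its sum detects membership in [B]; in [e |: D] only [e] lies there. *)
rewrite [X in f _ X]big_setU1 //= linearDr linear_sumr /=.
rewrite form_sum // cB odd_double setU11 big1 ?addr0 // => i iD.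
rewrite form_sum // cB odd_double /B !inE.
have -> : i == e = false by apply: contraNF eD => /eqP <-.
by move: iD; rewrite inE => ->.
Qed.
End Generation.

(** * The three generators and their orders *)

Lemma rotation_order (p : 'I_n.+2 -> 'rV_n.+1) (z : {'GL_n.+1['F_2]}) :
    ~~ odd n.+1 -> equiangular p ->
  (forall i, p i *m GLval z = p (i + 1)) -> #[z]%g = n.+2.
Proof.
move=> evn pE pz.
have pzX k i : p i *m GLval (z ^+ k)%g = p (i + k%:R).
  elim: k => [|k IHk]; first by rewrite mulmx1 addr0.
  by rewrite expgSr GL_MxE mulmxA IHk pz -natr1 addrA.
have zX k : (z ^+ k == 1)%g = (n.+2 %| k)%N.
  have <- : (k%:R == 0 :> 'I_n.+2) = (n.+2 %| k)%N.
    by rewrite -val_eqE [val _](@val_Zp_nat n.+2).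
  apply/eqP/eqP => [zk1|k0].
    (* Otherwise the vector of index k would equal [p 0] and still have value 1 against it, although
       [f] is alternating. *)
    apply: contraTeq isT => k0; have := pE (0 + k%:R) 0.
    by rewrite -pzX zk1 mulmx1 f_alt add0r k0.
  apply: GL_eqP => u.
  have [c ->] := equiangular_span u evn (equiangular_lift pE).
  rewrite mulmx1 mulmx_suml; apply: eq_bigr => i _.
  by rewrite -scalemxAl /= pzX k0 addr0.
by apply/eqP; rewrite eqn_dvd order_dvdn zX dvdnn -zX expg_order eqxx.
Qed.

Lemma symplectic_generators : ~~ odd n.+1 -> (2 < n)%N ->
  exists x y z : {'GL_n.+1['F_2]},
    [/\ #[x]%g = 2%N, #[y]%g = 2%N, #[z]%g = n.+2
      & <<[set x; y; z]>>%g = symplectic_group (n := n.+1) f].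
Proof.
move=> evn n2; have [p pE] := exists_equiangular_top evn.
have [|z Spz pz] := equiangular_isometry (q := fun i => p (i + 1)) evn pE.
  by move=> i j; rewrite pE (inj_eq (addIr 1)).
have [A4 A4E] : exists A : {set 'I_n.+2}, #|A| = 4%N.
  have /card_geqP[s [Us s4 _]] : (4 <= #|'I_n.+2|)%N.
    by rewrite card_ord !ltnS ltnW.
  by exists [set i in s]; rewrite cardsE (card_uniqP Us).
pose x := transvection (p 0 + p 1); pose y := transvection (\sum_(i in A4) p i).
exists x, y, z; split.
- apply: transvection_order; apply: contra_eq_neq (pE 0 1) => p01.
  have -> : p 0 = p 1 by rewrite -[p 0]addr0 -(F2_addvv (p 1)) addrA p01 add0r.
  by rewrite f_alt.
- apply: transvection_order; have [i iA] : exists i, i \in A4.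
    by apply/set0Pn; rewrite -card_gt0 A4E.
  by apply: contra_eq_neq (form_sum A4 i pE) => ->; rewrite linear0l A4E iA.
- exact: rotation_order pz.
set H := <<_>>%g.
have [Hx Hy Hz] : [/\ x \in H, y \in H & z \in H].
  by split; apply: mem_gen; rewrite !inE eqxx ?orbT.
apply/eqP; rewrite eqEsubset gen_subG !subUset !sub1set Spz andbT.
rewrite !transvection_symplectic /=.
apply: symplectic_sub_transvections => v.
have Hpair i j : transvection (p i + p j) \in H.
  apply: (transvection_pair pE) => {i j} i.
  (* Starting from [x], each conjugation by [z] shifts both indices by one. *)
  rewrite -[i](natr_Zp i); elim: (val _) => [|k IHk]; first by rewrite add0r.
  have := groupJ IHk Hz; rewrite transvection_conj // mulmxDl !pz.
  by rewrite -natr1.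
have [A evA ->] := equiangular_span_even v evn pE.
exact: (transvection_even evn pE Hpair A4E Hy evA).
Qed.
End Transvections.

Local Close Scope ring_scope.

Theorem corollary1p1 (g : nat) (hg : 13 <= g)
    (f : {skew_symmetric 'rV['F_2]_(2 * ((g - 1) %/ 2)).-1.+1}%R)
    (hf : is_psymplectic f) :
  (odd g ->
     exists x y z : {'GL_(2 * ((g - 1) %/ 2))['F_2]},
       [/\ #[x]%g = 2, #[y]%g = 2, #[z]%g = g
         & <<[set x; y; z]>>%g = symplectic_group f]) /\
  (~~ odd g ->
     exists x y z : {'GL_(2 * ((g - 1) %/ 2))['F_2]},
       [/\ #[x]%g = 2, #[y]%g = 2, #[z]%g = g - 1
         & <<[set x; y; z]>>%g = symplectic_group f]).
Proof.
have [f_nondeg _ /(_ isT) f_alt] := hf.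
have {hf}f_radical u : (forall v, f u v = 0)%R -> u = 0%R.
  move=> fu; apply/eqP; rewrite -memv0 -(eqP f_nondeg).
  by apply/mem_orthovP => v _; apply: fu.
(* For either parity of [g], the required order is the dimension plus one. *)
have m_def : ((if odd g then g else g - 1) = (2 * ((g - 1) %/ 2)).+1)%N.
  by case: ifP; lia.
suff [x [y [z [ox oy oz genxyz]]]] :
    exists x y z : {'GL_(2 * ((g - 1) %/ 2))['F_2]},
    [/\ #[x]%g = 2%N, #[y]%g = 2%N, #[z]%g = (2 * ((g - 1) %/ 2)).+1%N
      & <<[set x; y; z]>>%g = symplectic_group f].
  split=> g_odd; exists x, y, z;
    by split; rewrite // oz -m_def; case: ifP g_odd.
have : (12 <= 2 * ((g - 1) %/ 2))%N by lia.
have : ~~ odd (2 * ((g - 1) %/ 2)) by rewrite mul2n odd_double.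
clear m_def f_nondeg.
(* Once the dimension is a successor, the size [.-1.+1] of the form reduces to it by computation. *)
move: (2 * _) f f_alt f_radical => [//|n] f f_alt f_radical evn n12.
by apply: symplectic_generators => //; rewrite -ltnS (leq_trans _ n12).
Qed.
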